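(* Let $G$ be a finite vertex-transitive graph with $V$ vertices (labelled $1,\dots,V$), common vertex degree $d$, and adjacency matrix $A$ with eigenvalues $\lambda_1,\dots,\lambda_V$ (with multiplicity). Consider the simple random walk on $G$, and let $i\neq j$ be vertices. Then, for $|t|<1$, $$\sum_{n=1}^\infty P(\tau_{i,j}=n)\,t^n=\frac{V\,\det_{j,i}\!\left(I-\frac{t}{d}A\right)}{\sum_{m=1}^{V}\prod_{l\neq m}\left(1-\frac{t}{d}\lambda_l\right)},$$ where $\det_{j,i}(B)$ denotes the determinant of the matrix obtained from $B$ by removing the $j$th row and the $i$th column, and the product is over $l\in\{1,\dots,V\}\setminus\{m\}$.
   Context: A graph is vertex-transitive if for any two vertices $u,v$ there is a graph automorphism $\phi$ with $\phi(u)=v$. The simple random walk $(X_t)_{t\ge0}$ moves at each step to a uniformly chosen neighbour of the current vertex, i.e. it has transition matrix $\frac1d A$. The hitting time is $\tau_{i,j}=\inf\{t: X_t=j\}$ for the walk started at $X_0=i$.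
   Formalization: det_{j,i}(B) is taken as the signed minor (cofactor), i.e. (-1)^{i+j} times the determinant of B without row j and column i; with the unsigned determinant the formula fails, e.g. for two vertices joined by an edge, where the left side is t and the right side is -t. *)

(* Defs.v *)
(* MathComp / MathComp-Analysis *)
From HB Require Import structures.
From mathcomp Require Import all_boot all_order all_algebra.
From mathcomp Require Import perm.
From mathcomp Require Import all_classical all_reals all_analysis.
From mathcomp Require Import complex.

Set Implicit Arguments.
Unset Strict Implicit.
Unset Printing Implicit Defensive.

Import Order.TTheory GRing.Theory Num.Theory.
Import numFieldNormedType.Exports.

Local Open Scope classical_set_scope.
Local Open Scope ring_scope.

Definition simple_graph (V : nat) (e : rel 'I_V) : Prop :=
  symmetric e /\ irreflexive e.

Definition graph_automorphism (V : nat) (e : rel 'I_V) (phi : {perm 'I_V}) :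
    Prop :=
  forall u v, e (phi u) (phi v) = e u v.

Definition vertex_transitive (V : nat) (e : rel 'I_V) : Prop :=
  forall u v, exists2 phi : {perm 'I_V}, graph_automorphism e phi & phi u = v.

Definition regular_graph (V : nat) (e : rel 'I_V) (d : nat) : Prop :=
  forall u, #|[set v | e u v]%SET| = d.

Definition adjacency (F : pzRingType) (V : nat) (e : rel 'I_V) : 'M[F]_V :=
  \matrix_(u, v) (e u v)%:R.

Definition eigenvalues_with_mult (F : comNzRingType) (V : nat) (A : 'M[F]_V)
    (lam : 'I_V -> F) : Prop :=
  char_poly A = \prod_(l < V) ('X - (lam l)%:P).

(* Time-homogeneous Markov chain on 'I_V, started at i, with transition matrix
   M; the Markov property is written without conditional probabilities, so that
   it needs no proviso on null events. *)
Definition markov_chain (dsp : measure_display) (Om : measurableType dsp)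
    (R : realType) (P : probability Om R) (V : nat) (M : 'M[R]_V) (i : 'I_V)
    (X : nat -> Om -> 'I_V) : Prop :=
  [/\ forall n v, measurable [set w | X n w = v],
      P [set w | X 0%N w = i] = 1%E &
      forall (n : nat) (x : nat -> 'I_V),
        P [set w | forall k, (k <= n.+1)%N -> X k w = x k] =
        (P [set w | forall k, (k <= n)%N -> X k w = x k]
           * (M (x n) (x n.+1))%:E)%E].

(* No walk exists when d = 0: then the matrix is 0, so that no trajectory of
   length 1 has positive probability. *)
Definition simple_random_walk (dsp : measure_display) (Om : measurableType dsp)
    (R : realType) (P : probability Om R) (V : nat) (e : rel 'I_V) (d : nat)
    (i : 'I_V) (X : nat -> Om -> 'I_V) : Prop :=
  markov_chain P (d%:R^-1 *: adjacency R e) i X.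

(* Valued in \bar R: the value is +oo when j is never visited. *)
Definition hitting_time (R : realType) (Om : Type) (V : nat)
    (X : nat -> Om -> 'I_V) (j : 'I_V) (w : Om) : \bar R :=
  ereal_inf [set (n%:R)%:E | n in [set n | X n w = j]].

Definition prob_hit (dsp : measure_display) (Om : measurableType dsp)
    (R : realType) (P : probability Om R) (V : nat) (X : nat -> Om -> 'I_V)
    (j : 'I_V) (n : nat) : R :=
  fine (P [set w | hitting_time R X j w = (n%:R)%:E]).

(* (-1)^(j+i) times the determinant of B without row j and column i. The sign
   is indispensable: for the complete graph on two vertices, the hitting
   probabilities have generating function t, while the unsigned minor of
   I - tA at the off-diagonal positions is -t. *)
Definition signed_minor (F : pzRingType) (V : nat) (B : 'M[F]_V)
    (j i : 'I_V) : F :=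
  cofactor B j i.

(* Main.v *)
(** Fix the target [j], put [B = I - (t/d) A], and let [F u] be the generating
    function of the hitting time of [j] from [u].  Conditioning on the first
    step gives, for [u <> j],
      [F u = t M_uj + t \sum_(v <> j) M_uv F v]     ([M = A / d]).
    Row [u] of [B *m \adj B = \det B] says that the cofactor ratio
    [y u = cof_ju B / cof_jj B] satisfies the same system, and [y] minus the
    [N]-th partial sum of [F] is at most [|t|^N \sum_v |y v|] in norm because
    [M] is stochastic.  The cofactor [cof_jj B] is nonzero by an l1 estimate
    on a left null vector; by vertex-transitivity it is [1/V] times the sum of
    all diagonal cofactors, which is read off the derivative of the
    characteristic polynomial. *)
Require Import Defs.
From HB Require Import structures.
From mathcomp Require Import all_boot all_order all_algebra.
From mathcomp Require Import perm fingroup.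
From mathcomp Require Import all_classical all_reals all_analysis.
From mathcomp Require Import complex.
From mathcomp Require Import ring.

Set Implicit Arguments.
Unset Strict Implicit.
Unset Printing Implicit Defensive.

Import Order.TTheory GRing.Theory Num.Theory.
Import numFieldNormedType.Exports.

Local Open Scope classical_set_scope.
Local Open Scope ring_scope.
Local Open Scope complex_scope.

(** * Cofactors, determinants and the characteristic polynomial *)

Lemma deriv_prod (R : comNzRingType) n (f : 'I_n -> {poly R}) :
  (\prod_(i < n) f i)^`() =
  \sum_(i < n) (f i)^`() * \prod_(k < n | k != i) f k.
Proof.
elim: n f => [|n IHn] f; first by rewrite !big_ord0 derivC.
rewrite !big_ord_recl derivM IHn; congr (_ * _ + _).
  by rewrite [RHS]big_mkcond big_ord_recl /= mul1r.
rewrite /= mulr_sumr; apply: eq_bigr => i _.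
rewrite [X in _ = _ * X]big_mkcond big_ord_recl /= mulrCA; congr (_ * (_ * _)).
by rewrite [LHS]big_mkcond; apply: eq_bigr => k _; rewrite (inj_eq lift_inj).
Qed.

(** Apply the product rule to each Leibniz term: the entry in row [k] has derivative 1 on the
    diagonal and 0 elsewhere, so only the permutations fixing [k] survive, and they expand the
    [k]-th diagonal cofactor. *)
Lemma deriv_char_poly (R : comNzRingType) n (A : 'M[R]_n) :
  (char_poly A)^`() = \sum_(k < n) cofactor (char_poly_mx A) k k.
Proof.
have entry k l : (char_poly_mx A k l)^`() = (k == l)%:R.
  by rewrite !mxE derivB derivC subr0 derivMn derivX.
have term (s : 'S_n) :
    ((-1) ^+ s * \prod_i char_poly_mx A i (s i))^`() =
    \sum_k (if s k == k then
      (-1) ^+ s * \prod_(i | k != i) char_poly_mx A i (s i) else 0).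
  have -> (p : {poly R}) : ((-1) ^+ s * p)^`() = (-1) ^+ s * p^`().
    by case: (odd_perm s); rewrite ?mulN1r ?mul1r ?derivN.
  rewrite deriv_prod mulr_sumr; apply: eq_bigr => k _.
  rewrite entry [s k == k]eq_sym.
  case: eqP => _; rewrite ?mul0r ?mulr0 // mul1r.
  by congr (_ * _); apply: eq_bigl => i; rewrite eq_sym.
rewrite /char_poly /determinant raddf_sum /= (eq_bigr _ (fun s _ => term s)).
rewrite exchange_big; apply: eq_bigr => k _ /=.
by rewrite expand_cofactor [RHS]big_mkcond.
Qed.

(** Conjugation by [p] maps the permutations fixing [k] onto those fixing [p k], and preserves signs
    and products of entries. *)
Lemma cofactor_conj_perm (R : comNzRingType) n (B : 'M[R]_n) (p : 'S_n) k :
    (forall u v, B (p u) (p v) = B u v) ->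
  cofactor B (p k) (p k) = cofactor B k k.
Proof.
move=> Bp; rewrite !expand_cofactor.
rewrite (reindex_inj (conjg_inj p)) /=.
apply: eq_big => [s|s sk]; first by rewrite permJ (inj_eq perm_inj).
rewrite odd_permJ; congr (_ * _).
rewrite (reindex_inj (@perm_inj _ p)) /=.
by apply: eq_big => [u|u _]; rewrite ?(inj_eq perm_inj)// permJ Bp.
Qed.

Lemma det1B_neq0 (F : numFieldType) n (M : 'M[F]_n) (t : F) :
    (forall u, \sum_v `|M u v| <= 1) -> `|t| < 1 ->
  \det (1%:M - t *: M) != 0.
Proof.
move=> M1 t1; apply/det0P => -[z z0].
(* A left null vector satisfies [z = t z M], and the row-sum bound makes [z M] no larger than [z] in
   l1 norm. *)
rewrite mulmxBr mulmx1 -scalemxAr => /subr0_eq zE.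
pose S : F := \sum_v `|z 0 v|.
have SE : S <= `|t| * S.
  have zvE v : `|z 0 v| = `|\sum_u t * (z 0 u * M u v)|.
    by rewrite {1}zE !mxE mulr_sumr.
  rewrite {1}/S (eq_bigr _ (fun v _ => zvE v)).
  apply: (@le_trans _ _ (\sum_v \sum_u `|t| * (`|z 0 u| * `|M u v|))).
    apply: ler_sum => v _; apply: le_trans (ler_norm_sum _ _ _) _.
    by apply: ler_sum => u _; rewrite !normrM.
  rewrite exchange_big mulr_sumr; apply: ler_sum => u _ /=.
  by rewrite -mulr_sumr -mulr_sumr ler_wpM2l // ler_piMr.
have S0 : 0 <= S by apply: sumr_ge0.
have : S == 0.
  rewrite eq_le S0 andbT; move: SE; rewrite -subr_le0 -{1}[S]mul1r -mulrBl.
  by rewrite pmulr_rle0 // subr_gt0.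
rewrite psumr_eq0 // => /allP z0'; case/negP: z0; apply/eqP/rowP => v.
by apply/eqP; rewrite mxE -normr_eq0 (implyP (z0' v (mem_index_enum v))).
Qed.

(** Deleting row and column [j] leaves a matrix of the same form whose row sums are still at most
    1. *)
Lemma cofactor1B_neq0 (F : numFieldType) n (M : 'M[F]_n) (t : F) j :
    (forall u, \sum_v `|M u v| <= 1) -> `|t| < 1 ->
  cofactor (1%:M - t *: M) j j != 0.
Proof.
move=> M1 t1; rewrite /cofactor mulf_neq0 ?signr_eq0 //.
have -> : row' j (col' j (1%:M - t *: M)) = 1%:M - t *: row' j (col' j M).
  by apply/matrixP=> u v; rewrite !mxE (inj_eq lift_inj).
apply: det1B_neq0 => // u; apply: le_trans (M1 (lift j u)).
rewrite [leRHS](bigD1_ord j) //= -[leLHS]add0r lerD //.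
by apply: ler_sum => v _; rewrite !mxE.
Qed.

(** For [s != 0], write [I - sA = s (s^-1 I - A)]: its cofactors are [s^(n-1)] times those of the
    characteristic matrix at [s^-1], whose diagonal sum is the derivative of the characteristic
    polynomial. *)
Lemma sum_cofactor1B (F : fieldType) n (A : 'M[F]_n) (lam : 'I_n -> F) s :
    char_poly A = \prod_(l < n) ('X - (lam l)%:P) ->
  \sum_(k < n) cofactor (1%:M - s *: A) k k =
  \sum_(m < n) \prod_(l < n | l != m) (1 - s * lam l).
Proof.
move=> AE; have [->|s0] := eqVneq s 0.
  apply: eq_bigr => k _; rewrite scale0r subr0 big1 => [|l _]; last first.
    by rewrite mul0r subr0.
  by have := congr1 (fun B : 'M[F]_n => B k k) (adj1 F n); rewrite !mxE eqxx.
have sE k : cofactor (1%:M - s *: A) k k =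
    s ^+ n.-1 * (cofactor (char_poly_mx A) k k).[s^-1].
  rewrite -horner_evalE -cofactor_map_mx -cofactorZ; congr (cofactor _ k k).
  apply/matrixP=> u v; rewrite !mxE /= horner_evalE hornerD hornerN hornerC.
  by rewrite hornerMn hornerX mulrBr mulrnAr mulfV.
under eq_bigr do rewrite sE.
rewrite -mulr_sumr -horner_sum -deriv_char_poly AE deriv_prod.
rewrite horner_sum mulr_sumr.
apply: eq_bigr => m _; rewrite derivB derivX derivC subr0 mul1r horner_prod.
(* The [n - 1] factors [s] are shared out, one to each [l != m]. *)
have -> : n.-1 = #|[pred l : 'I_n | l != m]| by rewrite cardC1 card_ord.
rewrite -prodr_const -big_split /=; apply: eq_bigr => l _.
by rewrite hornerXsubC mulrBr mulfV.
Qed.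

(** * First-passage probabilities of a Markov chain *)

(* Since [first_passage] is indexed from 0, [first_passage M j n u] is the
   probability that the walk from [u] first visits [j] after time 0 at time
   [n.+1]. *)
Fixpoint first_passage (F : pzRingType) V (M : 'M[F]_V) (j : 'I_V) (n : nat)
    (u : 'I_V) : F :=
  if n is m.+1 then \sum_(v < V | v != j) M u v * first_passage M j m v
  else M u j.

Lemma map_first_passage (F G : pzRingType) (f : {rmorphism F -> G}) V
    (M : 'M[F]_V) j n u :
  first_passage (map_mx f M) j n u = f (first_passage M j n u).
Proof.
elim: n u => [|n IHn] u /=; first by rewrite mxE.
by rewrite rmorph_sum; apply: eq_bigr => v _; rewrite IHn mxE rmorphM.
Qed.

Section MarkovChain.
Context (dsp : measure_display) (Om : measurableType dsp) (R : realType).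
Context (P : probability Om R) (V : nat) (M : 'M[R]_V) (i : 'I_V).
Context (X : nat -> Om -> 'I_V) (XM : markov_chain P M i X).

Let mX n v : measurable [set w | X n w = v].
Proof. by case: XM. Qed.

Let mpath m (x : nat -> 'I_V) :
  measurable [set w | forall k, (k <= m)%N -> X k w = x k].
Proof.
apply: (@bigcap_measurableType _ _ (fun k => [set w | X k w = x k])) => k _.
exact: mX.
Qed.

Let mavoid (Q : nat -> Prop) j :
  measurable [set w | forall k, Q k -> X k w <> j].
Proof.
apply: (@bigcap_measurableType _ _ (fun k => ~` [set w | X k w = j])) => k _.
exact/measurableC/mX.
Qed.

Lemma total_probability m (D : set Om) : measurable D ->
  P D = (\sum_(v < V) P (D `&` [set w | X m w = v]))%E.
Proof.
(* Additivity is stated for sequences of sets, so [F] is indexed by all naturals and is empty from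
   [V] on. *)
move=> mD; pose F k := D `&` [set w | X m w = k :> nat].
have FE (v : 'I_V) : F v = D `&` [set w | X m w = v].
  by congr (_ `&` _); apply/seteqP; split=> w /=; [exact: val_inj | move->].
have mF k : measurable (F k).
  have [kV|kV] := ltnP k V.
    by rewrite (FE (Ordinal kV)); exact: measurableI.
  rewrite (_ : F k = set0) //; apply/seteqP; split=> // w [_ /= wk].
  by move: kV; rewrite -wk leqNgt ltn_ord.
have tF : trivIset setT F by move=> k l _ _ [w [[_ <-] [_ <-]]].
transitivity (P (\big[setU/set0]_(k < V) F k)).
  congr (P _); rewrite -bigcup_mkord; apply/seteqP; split=> [w Dw|w [k _ []]//].
  by exists (X m w) => //=.
by rewrite measure_bigsetU //; apply: eq_bigr => v _; rewrite FE.
Qed.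

(** The Markov property is given for whole trajectories, so the past is kept as a full path [x] up
    to time [m]; both vary in the induction on [n]. *)
Lemma path_first_passage j n m (x : nat -> 'I_V) :
  P [set w | (forall k, (k <= m)%N -> X k w = x k) /\
             (forall k, (m < k < m + n.+1)%N -> X k w <> j) /\
             X (m + n.+1)%N w = j] =
  (P [set w | forall k, (k <= m)%N -> X k w = x k]
     * (first_passage M j n (x m))%:E)%E.
Proof.
(* Decompose over the position at time [m.+1]; [ext m x v] is the path [x] up to
   time [m] continued by [v]. *)
pose ext m (x : nat -> 'I_V) v k := if (k <= m)%N then x k else v.
have extP l y v w : (forall k, (k <= l.+1)%N -> X k w = ext l y v k) <->
    (forall k, (k <= l)%N -> X k w = y k) /\ X l.+1 w = v.
  split=> [Xy|[Xy Xv] k].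
    split=> [k kl|]; first by rewrite Xy 1?leqW // /ext kl.
    by rewrite Xy // /ext ltnn.
  rewrite leq_eqVlt ltnS /ext => /orP[/eqP ->|kl]; first by rewrite ltnn.
  by rewrite kl Xy.
have step l y v : P [set w | forall k, (k <= l.+1)%N -> X k w = ext l y v k] =
    (P [set w | forall k, (k <= l)%N -> X k w = y k] * (M (y l) v)%:E)%E.
  have [_ _ ->] := XM; rewrite {2 3}/ext leqnn ltnn; congr (P _ * _)%E.
  by apply/seteqP; split=> w /= Xy k kl; rewrite Xy // /ext kl.
elim: n m x => [|n IHn] m x.
  rewrite -step; congr (P _); apply/seteqP; split=> w /=; rewrite addn1.
    by move=> [Xx [_ Xj]]; apply/extP.
  move/extP => [Xx Xj]; split=> //; split=> // k /andP[mk].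
  by rewrite ltnS leqNgt mk.
rewrite (total_probability m.+1); last first.
  apply: measurableI; first exact: mpath.
  apply: measurableI; last exact: mX.
  exact: (mavoid (fun k => (m < k < m + n.+2)%N)).
(* Being at [j] at time [m.+1] contradicts avoidance, as [m.+1 < m + n.+2]. *)
rewrite (bigD1 j) //= [X in P X](_ : _ = set0) ?measure0 ?add0e; last first.
  apply/seteqP; split=> // w [[_ [Xk _]] Xj]; apply: (Xk m.+1) => //.
  by rewrite ltnSn addnS ltnS addnS ltnS leq_addr.
have -> : P [set w | forall k, (k <= m)%N -> X k w = x k] =
    (fine (P [set w | forall k, (k <= m)%N -> X k w = x k]))%:E.
  by rewrite fineK // fin_num_measure //; exact: mpath.
rewrite -EFinM mulr_sumr -sumEFin; apply: eq_bigr => v vj.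
rewrite mulrA !EFinM fineK; last by rewrite fin_num_measure //; exact: mpath.
rewrite -step [in first_passage _ _ _ v](_ : v = ext m x v m.+1); last first.
  by rewrite /ext ltnn.
rewrite -IHn; congr (P _); apply/seteqP; split=> w /=; rewrite !addnS addSn.
  move=> [[Xx [Xk Xj]] Xv]; split; first exact/extP.
  by split=> // k /andP[mk kn]; apply: Xk; rewrite (ltnW mk).
move=> [/extP[Xx Xv] [Xk Xj]]; do 2![split=> //].
split=> // k; rewrite leq_eqVlt => /andP[/orP[/eqP <- _|mk kn]].
  by rewrite Xv; exact/eqP.
by apply: Xk; rewrite mk.
Qed.

Lemma prob_hitS j n : i != j -> prob_hit P X j n.+1 = first_passage M j n i.
Proof.
move=> ij; have [_ X0 _] := XM.
rewrite /prob_hit.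
have -> : [set w | hitting_time R X j w = (n.+1%:R)%:E] =
    [set w | (forall k, (k < n.+1)%N -> X k w <> j) /\ X n.+1 w = j].
  apply/seteqP; split=> w /=.
    move=> hE; have lb k : X k w = j -> (n.+1 <= k)%N.
      move=> Xk; have : (hitting_time R X j w <= (k%:R)%:E)%E.
        by apply: ereal_inf_lbound; exists k.
      by rewrite hE lee_fin ler_nat.
    split=> [k kn Xk|]; first by have := lb k Xk; rewrite leqNgt kn.
    (* Some visit lies within 1 of the infimum, at a time [k < n.+2]; with [lb] this forces
       [k = n.+1]. *)
    have /(@lb_ereal_inf_adherent _ _ _ ltr01) :
        hitting_time R X j w \is a fin_num by rewrite hE.
    rewrite -/(hitting_time R X j w) hE => -[_ [k Xk <-]].
    rewrite -EFinD lte_fin -natr1 natr1 natr1 ltr_nat ltnS => kn.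
    by have /eqP <- : k == n.+1 by rewrite eqn_leq kn lb.
  move=> [Xk Xn]; apply/eqP; rewrite eq_le; apply/andP; split.
    by apply: ereal_inf_lbound; exists n.+1.
  apply: le_ereal_inf_tmp => _ [k Xkj <-]; rewrite lee_fin ler_nat leqNgt.
  by apply/negP => kn; exact: Xk Xkj.
rewrite (total_probability 0); last first.
  apply: measurableI; last exact: mX.
  exact: (mavoid (fun k => (k < n.+1)%N)).
(* Starting points other than [i] carry no mass, because [X 0 = i] has probability 1. *)
rewrite (bigD1 i) //= [X in (_ + X)%E]big1 => [|v vi]; last first.
  apply/eqP; rewrite -measure_le0.
  have <- : P (~` [set w | X 0%N w = i]) = 0%E.
    by rewrite probability_setC // X0 subee.
  apply: le_measure; rewrite ?inE //.
  - apply: measurableI; last exact: mX.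
    apply: measurableI; last exact: mX.
    exact: (mavoid (fun k => (k < n.+1)%N)).
  - exact/measurableC/mX.
  - by move=> w [_ /= ->]; exact/eqP.
rewrite adde0.
have -> : (fun w => (forall k, (k < n.+1)%N -> X k w <> j) /\ X n.+1 w = j) `&`
      [set w | X 0%N w = i] =
    [set w | (forall k, (k <= 0)%N -> X k w = i) /\
             (forall k, (0 < k < 0 + n.+1)%N -> X k w <> j) /\
             X (0 + n.+1)%N w = j].
  apply/seteqP; split=> w /=; rewrite add0n.
    move=> [[Xk Xj] X0i]; split=> [k|]; first by rewrite leqn0 => /eqP ->.
    by split=> // k /andP[_]; exact: Xk.
  move=> [X0i [Xk Xj]]; split; last exact: X0i.
  split=> // -[_|k kn]; first by rewrite X0i //; exact/eqP.
  by apply: Xk.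
rewrite (path_first_passage j n 0 (fun=> i)).
rewrite [X in (P X * _)%E](_ : _ = [set w | X 0%N w = i]) ?X0 ?mul1e //.
apply/seteqP; split=> w /= Xi; first exact: Xi.
by move=> k; rewrite leqn0 => /eqP ->.
Qed.

End MarkovChain.

(** * First-step equations and convergence *)

(** The partial sums obey the same first-step recursion as [y], so each remainder is [t] times a
    combination, with weights of total norm at most 1, of the previous remainders. Each step gains a
    factor [|t|]. *)
Lemma first_passage_remainder (F : numFieldType) V (M : 'M[F]_V) (j : 'I_V)
    (t C : F) (y : 'I_V -> F) :
    (forall u, \sum_v `|M u v| <= 1) -> (forall v, `|y v| <= C) ->
    (forall u, u != j ->
      y u = t * M u j + t * \sum_(v < V | v != j) M u v * y v) ->
  forall N u, u != j ->
  `|y u - \sum_(n < N) first_passage M j n u * t ^+ n.+1| <= `|t| ^+ N * C.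
Proof.
move=> M1 yC yE; elim=> [|N IHN] u uj.
  by rewrite big_ord0 subr0 mul1r.
have C0 : 0 <= C := le_trans (normr_ge0 _) (yC u).
pose s v := y v - \sum_(n < N) first_passage M j n v * t ^+ n.+1.
have -> : y u - \sum_(n < N.+1) first_passage M j n u * t ^+ n.+1 =
    t * \sum_(v < V | v != j) M u v * s v.
  rewrite big_ord_recl /= expr1 (yE u uj) [M u j * t]mulrC.
  rewrite [t * M u j + t * _]addrC addrKA.
  rewrite [X in X - _]mulr_sumr mulr_sumr.
  under [X in _ - X]eq_bigr do rewrite mulr_suml.
  rewrite exchange_big -sumrB; apply: eq_bigr => v _.
  rewrite /s !mulrBr; congr (_ - _); rewrite !mulr_sumr.
  by apply: eq_bigr => n _; rewrite /bump /= add1n [in LHS]exprS; ring.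
rewrite normrM exprS -mulrA ler_wpM2l //.
apply: le_trans (ler_norm_sum _ _ _) _.
apply: (@le_trans _ _ (\sum_(v < V | v != j) `|M u v| * (`|t| ^+ N * C))).
  by apply: ler_sum => v vj; rewrite normrM ler_wpM2l // IHN.
rewrite -mulr_suml ler_piMl ?mulr_ge0 ?exprn_ge0 //.
by apply: le_trans (M1 u); rewrite [leRHS](bigD1 j) //= lerDr.
Qed.

(** This is the vanishing off-diagonal entry [(u, j)] of [B *m \adj B]. *)
Lemma cofactor1B_first_step (F : fieldType) n (M : 'M[F]_n) t (u j : 'I_n) :
    u != j ->
  cofactor (1%:M - t *: M) j u =
  t * \sum_v M u v * cofactor (1%:M - t *: M) j v.
Proof.
move=> uj; set B := 1%:M - t *: M.
have := congr1 (fun A : 'M[F]_n => A u j) (mul_mx_adj B).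
rewrite !mxE (negPf uj) mulr0n => sum0; apply/eqP.
rewrite -subr_eq0; apply/eqP; rewrite -[RHS]sum0 mulr_sumr.
under [RHS]eq_bigr do rewrite !mxE mulrBl.
rewrite sumrB; congr (_ - _); last by apply: eq_bigr => v _; rewrite mulrA.
rewrite (bigD1 u) //= eqxx mul1r big1 ?addr0 // => v vu.
by rewrite eq_sym (negPf vu) mul0r.
Qed.

Lemma cofactor1B_ratio_first_step (F : fieldType) n (M : 'M[F]_n) t (u j : 'I_n)
    (c := cofactor (1%:M - t *: M) j) :
    c j != 0 -> u != j ->
  c u / c j = t * M u j + t * \sum_(v < n | v != j) M u v * (c v / c j).
Proof.
move=> cj uj; rewrite {1}/c cofactor1B_first_step // -/c (bigD1 j) //=.
rewrite mulrDr mulrDl mulrA mulfK // -mulrA mulr_suml; congr (_ + t * _).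
by apply: eq_bigr => v _; rewrite -mulrA.
Qed.

(** Norms in [R[i]] are complex numbers that happen to be real; real parts carry the bound to [R],
    where the geometric sequence converges. *)
Lemma cvg_geometric_remainder (R : realType) (t C l : R[i]) (s : nat -> R[i]) :
    `|t| < 1 -> (forall N, `|l - s N| <= `|t| ^+ N * C) ->
  (s : nat -> R[i]^o) @ \oo --> (l : R[i]^o).
Proof.
move=> t1 sl; apply/cvgrPdist_le => e e0.
have /RRe_real tE : `|t| \is Num.real by exact: normr_real.
have /RRe_real eE : e \is Num.real by exact: gtr0_real.
have C0 : 0 <= C by have := le_trans (normr_ge0 _) (sl 0%N); rewrite mul1r.
have /RRe_real CE : C \is Num.real by exact: ger0_real.
have r1 : `|complex.Re `|t| | < 1.
  rewrite ger0_norm; first by rewrite -ltcR tE.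
  by rewrite -ler0c tE.
have := @cvg_geometric R (complex.Re C) _ r1.
move=> /cvgrPdist_le/(_ (complex.Re e)).
rewrite -ltcR eE => /(_ e0); apply: filterS => N.
rewrite sub0r normrN /geometric /= -lecR eE => le_e.
apply: le_trans (sl N) _; apply: le_trans le_e.
have nn : 0 <= complex.Re C * complex.Re `|t| ^+ N.
  by rewrite mulr_ge0 ?exprn_ge0 // -ler0c ?CE ?tE.
by rewrite (ger0_norm nn) rmorphM rmorphXn /= CE tE mulrC.
Qed.

Theorem theorem5 (R : realType) (V d : nat) (e : rel 'I_V)
    (Gsimple : simple_graph e) (Gvt : vertex_transitive e)
    (Gdeg : regular_graph e d)
    (lam : 'I_V -> R[i])
    (lamE : eigenvalues_with_mult (adjacency R[i] e) lam)
    (dsp : measure_display) (Om : measurableType dsp) (P : probability Om R)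
    (i j : 'I_V) (ij : i != j)
    (X : nat -> Om -> 'I_V) (srw : simple_random_walk P e d i X)
    (t : R[i]) (t1 : `|t| < 1) :
  (fun N => \sum_(1 <= n < N) ((prob_hit P X j n)%:C * t ^+ n) : R[i]^o) @ \oo
  --> (V%:R * signed_minor (1%:M - (t / d%:R) *: adjacency R[i] e) j i
       / \sum_(m < V) \prod_(l < V | l != m) (1 - t / d%:R * lam l) : R[i]^o).
Proof.
pose M : 'M[R[i]]_V := d%:R^-1 *: adjacency R[i] e.
have ME : M = map_mx (real_complex R) (d%:R^-1 *: adjacency R e).
  by apply/matrixP=> u v; rewrite !mxE rmorphM fmorphV !rmorph_nat.
have M1 u : \sum_v `|M u v| <= 1.
  have -> : \sum_v `|M u v| = d%:R^-1 * d%:R.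
    rewrite -{2}(Gdeg u) -sum1_card natr_sum mulr_sumr [RHS]big_mkcond /=.
    apply: eq_bigr => v _; rewrite !mxE inE normrM normfV !normr_nat.
    by case: (e u v); rewrite ?mulr0.
  (* If [d = 0], then [d^-1] is 0 by convention and the row sums are 0, not 1. *)
  by have [->|d0] := eqVneq (d%:R : R[i]) 0; rewrite ?mulr0 ?mulVf.
have BE : 1%:M - (t / d%:R) *: adjacency R[i] e = 1%:M - t *: M.
  by rewrite scalerA.
pose y v := cofactor (1%:M - t *: M) j v / cofactor (1%:M - t *: M) j j.
have cj0 : cofactor (1%:M - t *: M) j j != 0 by exact: cofactor1B_neq0.
have V0 : (V%:R : R[i]) != 0.
  by rewrite pnatr_eq0 -lt0n (leq_ltn_trans _ (ltn_ord i)).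
have -> : V%:R * signed_minor (1%:M - (t / d%:R) *: adjacency R[i] e) j i
       / \sum_(m < V) \prod_(l < V | l != m) (1 - t / d%:R * lam l) = y i.
  rewrite -(sum_cofactor1B (t / d%:R) lamE) BE.
  rewrite [X in _ / X](_ : _ = V%:R * cofactor (1%:M - t *: M) j j).
    by rewrite /signed_minor -mulf_div divff // mul1r.
  rewrite (eq_bigr (fun=> cofactor (1%:M - t *: M) j j)) => [|k _].
    by rewrite sumr_const card_ord mulr_natl.
  have [p pA <-] := Gvt j k; apply: cofactor_conj_perm => u v.
  by rewrite !mxE pA (inj_eq perm_inj).
have yC v : `|y v| <= \sum_u `|y u|.
  by rewrite (bigD1 v) //= lerDl sumr_ge0.
(* After the shift the sum runs over [1 <= n < N.+1]: exactly [N] terms, matching the remainder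
   bound. *)
rewrite -(@cvg_shiftS R[i]^o
  (fun N => \sum_(1 <= n < N) ((prob_hit P X j n)%:C * t ^+ n))) /=.
apply: (@cvg_geometric_remainder R t (\sum_u `|y u|)) => // N.
rewrite big_add1 big_mkord.
under eq_bigr => n _.
  rewrite (prob_hitS srw) // -[_%:C]/(real_complex R _) -map_first_passage -ME.
  over.
apply: first_passage_remainder => // u uj.
exact: cofactor1B_ratio_first_step.
Qed.
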